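(* Let $e$ be a hyperedge with $r=|e|$ nodes and let $\mathbf{z}_e$ be a move-based $k$-way splitting function on $e$, with penalties $m_i$ ($0\le i\le r-1$) for partitions having exactly $i$ nodes of $e$ outside a largest cluster. Extend with a value $m_r$ and define $\mathbf{m}_e:2^e\to\mathbb{R}$ by $\mathbf{m}_e(S)=m_{|S|}$. If $m_r=m_{r-2}$ and $\mathbf{m}_e$ is submodular, then $\mathbf{z}_e$ can be modeled by an NMC-gadget.
   Context: For a finite set $e$ and integer $k\ge 2$, $\mathcal{P}_e$ is the set of $k$-tuples $P=(e_1,\dots,e_k)$ of pairwise disjoint (possibly empty) subsets of $e$ with union $e$; $|P|$ is the number of nonempty $e_i$. A $k$-way splitting function is $\mathbf{z}_e:\mathcal{P}_e\to\mathbb{R}$ with $\mathbf{z}_e(P)\ge0$, invariant under permuting the clusters, and $\mathbf{z}_e(P)=0$ when $|P|=1$. It is move-based if $\mathbf{z}_e(P)$ depends only on $\sum_{i\ne i_{\max}}|e_i|$, where $e_{i_{\max}}$ is a largest cluster; so $m_0=0$. $\mathbf{m}_e$ is submodular if $\mathbf{m}_e(A)+\mathbf{m}_e(B)\ge\mathbf{m}_e(A\cap B)+\mathbf{m}_e(A\cup B)$ for all $A,B\subseteq e$. An NMC-gadget for $e$ is an undirected graph $G'=(V',E')$ with $V'=e\cup\hat V$ ($\hat V$ auxiliary nodes) and node weights $\omega:V'\to\mathbb{R}_{\ge0}\cup\{\infty\}$ with $\omega(v)=\infty$ for $v\in e$; its splitting function is $\hat{\mathbf{z}}_e(P)=\min\{\omega(R):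 R\subseteq\hat V,\ e_i \text{ and } e_j \text{ are disconnected in } G'\setminus R \text{ for all } i\ne j\}$, where $\omega(R)=\sum_{v\in R}\omega(v)$ and $G'\setminus R$ is $G'$ with the nodes of $R$ deleted. $\mathbf{z}_e$ is modeled by the gadget if $\hat{\mathbf{z}}_e=\mathbf{z}_e$ on $\mathcal{P}_e$. *)

(* Defs.v *)
From HB Require Import structures.
From mathcomp Require Import all_boot all_order all_fingroup all_algebra.
From mathcomp Require Import reals constructive_ereal.
Set Implicit Arguments.
Unset Strict Implicit.
Unset Printing Implicit Defensive.
Import Order.TTheory GRing.Theory Num.Theory.
Local Open Scope ring_scope.

Section Splitting.
Variables (k : nat) (e : finType).

Definition is_kpart (P : {ffun 'I_k -> {set e}}) : bool :=
  (\bigcup_i P i == [set: e]) &&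
  [forall i, forall j, (i != j) ==> [disjoint P i & P j]].

Record kpart := KPart {
  cluster :> {ffun 'I_k -> {set e}};
  _ : is_kpart cluster
}.

Definition nb_clusters (P : kpart) : nat := #|[set i | P i != set0]|.

Definition largest (P : kpart) (i : 'I_k) : Prop :=
  forall j, (#|P j| <= #|P i|)%N.

Variable R : realType.

Definition splitting_function (z : kpart -> R) : Prop :=
  [/\ forall P, 0 <= z P,
      forall (P Q : kpart) (s : 'S_k), (forall i, Q i = P (s i)) -> z Q = z P
    & forall P, nb_clusters P = 1%N -> z P = 0].

(* [m i] is the penalty of a partition with exactly [i] nodes outside a
   largest cluster. When [k] is small some [i < #|e|] are not attained by any
   partition, and [m i] is then unconstrained here. *)
Definition move_based (z : kpart -> R) (m : nat -> R) : Prop :=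
  forall (P : kpart) (i : 'I_k), largest P i ->
    z P = m (\sum_(j < k | j != i) #|P j|)%N.

End Splitting.

Definition submodular (R : realType) (T : finType) (f : {set T} -> R) : Prop :=
  forall A B : {set T}, f A + f B >= f (A :&: B) + f (A :|: B).

Local Open Scope ereal_scope.

(* The node set V' is the disjoint sum of [e] (injected by [inl]) and the
   auxiliary nodes (injected by [inr]). *)
Record nmc_gadget (R : realType) (e : finType) := NMCGadget {
  aux : finType;
  edge : rel (e + aux);
  edge_sym : symmetric edge;
  edge_irr : irreflexive edge;
  weight : e + aux -> \bar R;
  weight_ge0 : forall v, 0 <= weight v;
  weight_terminal : forall v : e, weight (inl v) = +oo
}.

Section Gadget.
Variables (R : realType) (e : finType) (G : nmc_gadget R e).

Definition edge_del (D : {set aux G}) : rel (e + aux G) :=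
  [rel x y | [&& edge x y, x \notin [set inr v | v in D]
                         & y \notin [set inr v | v in D]]].

Definition separates k (D : {set aux G}) (P : kpart k e) : bool :=
  [forall i, forall j, (i != j) ==>
    [forall u in P i, forall v in P j,
       ~~ connect (edge_del D) (inl u) (inl v)]].

(* The minimum ranges over a finite family; it is +oo if the family is empty,
   i.e., if no set of auxiliary nodes separates the clusters. *)
Definition gadget_splitting k (P : kpart k e) : \bar R :=
  \big[mine/+oo]_(D : {set aux G} | separates D P)
    \sum_(v in D) weight (inr v : e + aux G).

Definition models k (z : kpart k e -> R) : Prop :=
  forall P : kpart k e, gadget_splitting P = (z P)%:E.

End Gadget.

(* Main.v *)
Require Import Defs.
From HB Require Import structures.
From mathcomp Require Import all_boot all_order all_fingroup all_algebra.
From mathcomp Require Import reals constructive_ereal.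
From mathcomp Require Import zify ring lra.
Set Implicit Arguments.
Unset Strict Implicit.
Unset Printing Implicit Defensive.
Import Order.TTheory GRing.Theory Num.Theory.
Local Open Scope ring_scope.

(** Submodularity makes [m] concave on [0..r], and [m r = m (r - 2)] then forces
    it to be nondecreasing on [0..r-1].  Hence on [0..r-1] it is a nonnegative
    combination of the truncations [i |-> min i t] for [1 <= t <= r - 1].  Each
    truncation is modeled by a subdivided star: every terminal is joined through
    a private node of weight 1 to a common centre of weight [t].  A separating
    set either contains the centre, at cost [t], or isolates from it all
    terminals outside one cluster, at cost at least [i].  Gluing the stars along
    the terminals adds up their splitting functions. *)

Section Partitions.
Variables (k : nat) (e : finType) (P : kpart k e).

Lemma kpart_disjoint i j v : v \in P i -> v \in P j -> i = j.
Proof.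
case: P => F /= /andP[_ /forallP disF] vi vj; apply/eqP/negPn/negP => nij.
have /forallP/(_ j) := disF i; rewrite nij /= => /pred0P/(_ v).
by rewrite /= vi vj.
Qed.

Lemma kpart_clusterP v : exists i, v \in P i.
Proof.
case: P => F /= /andP[/eqP covF _]; have : v \in \bigcup_i F i.
  by rewrite covF inE.
by case/bigcupP => i _ vi; exists i.
Qed.

(** Each node outside [P i] lies in exactly one other cluster. This turns the argument of the
    penalty into the size of a single complement. *)
Lemma sum_card_other_clusters i :
  (\sum_(j < k | j != i) #|P j| = #|~: P i|)%N.
Proof.
have cl_ex v : {i | v \in P i} by apply: sigW; exact: kpart_clusterP.
pose cl v := sval (cl_ex v).
have clE v j : (v \in P j) = (cl v == j).
  rewrite /cl; case: (cl_ex v) => l /= vl; apply/idP/eqP => [|<-//].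
  exact: kpart_disjoint.
rewrite -[RHS]sum1_card (partition_big cl (fun j => j != i)) => [|v] /=.
  apply: eq_bigr => j nji; rewrite -sum1_card; apply: eq_bigl => v.
  by rewrite inE !clE; case: eqP => [->|]; rewrite ?nji ?andbF.
by rewrite inE clE.
Qed.

Lemma exists_largest : (0 < k)%N -> exists i, largest P i.
Proof.
move=> k_gt0; case: (@arg_maxnP _ (Ordinal k_gt0) xpredT (fun i => #|P i|)) => //.
by move=> i _ maxi; exists i => j; exact: maxi.
Qed.

End Partitions.

Section TrivialPartition.
Variables (k : nat) (e : finType) (i0 : 'I_k).

(** Serves to derive [m 0 = 0]: only one cluster is nonempty and nothing lies outside it. *)
Definition trivial_cluster : {ffun 'I_k -> {set e}} :=
  [ffun i => if i == i0 then setT else set0].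

Lemma trivial_is_kpart : is_kpart trivial_cluster.
Proof.
apply/andP; split.
  by rewrite -subTset (bigcup_max i0) // ffunE eqxx.
apply/forallP => i; apply/forallP => j; apply/implyP => nij.
rewrite !ffunE -setI_eq0; case: (eqVneq i i0) => [ii0|_]; last by rewrite set0I.
by rewrite -ii0 [j == i]eq_sym (negPf nij) setI0.
Qed.

Definition trivial_kpart := KPart trivial_is_kpart.

End TrivialPartition.

Section StarGadget.
Variables (R : realType) (e : finType) (n : nat) (c : 'I_n -> R).
Hypothesis c_ge0 : forall t, 0 <= c t.

(* In the star of index [t], [Some v] is the private node of the terminal [v]
   and [None] is the centre, of weight [t + 1] relative to the private nodes. *)
Let node := ('I_n * option e)%type.

Definition star_edge (x y : e + node) : bool :=
  match x, y with
  | inl v, inr (_, Some u) | inr (_, Some u), inl v => v == u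
  | inr (s, Some _), inr (t, None) | inr (s, None), inr (t, Some _) => s == t
  | _, _ => false
  end.

Definition star_cost (a : node) : R :=
  if a.2 is Some _ then c a.1 else c a.1 * a.1.+1%:R.

Definition star_weight (x : e + node) : \bar R :=
  if x is inr a then (star_cost a)%:E else +oo%E.

Lemma star_edge_sym : symmetric star_edge.
Proof. by move=> [u|[s [u|]]] [v|[t [v|]]] //=; rewrite eq_sym. Qed.

Lemma star_edge_irr : irreflexive star_edge.
Proof. by move=> [u|[s [u|]]]. Qed.

Lemma star_cost_ge0 a : 0 <= star_cost a.
Proof. by case: a => t [v|]; rewrite /star_cost //= mulr_ge0. Qed.

Lemma star_weight_ge0 x : (0 <= star_weight x)%E.
Proof. by case: x => [v|a] /=; rewrite ?leey // lee_fin star_cost_ge0. Qed.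

Definition star_gadget : nmc_gadget R e :=
  @NMCGadget R e node star_edge star_edge_sym star_edge_irr
    star_weight star_weight_ge0 (fun=> erefl).

(** Splits the cost of a cut star by star, so that optimality can be checked in each star
    separately. *)
Lemma sum_star_cost (D : {set node}) :
  \sum_(a in D) star_cost a =
  \sum_t c t * (#|[set v | (t, Some v) \in D]| +
                ((t, None) \in D) * t.+1)%:R.
Proof.
pose cost t o := if (t, o) \in D then star_cost (t, o) else 0.
have -> : \sum_(a in D) star_cost a = \sum_t \sum_o cost t o.
  by rewrite pair_bigA big_mkcond; apply: eq_bigr => -[t o] _.
rewrite {}/cost; apply: eq_bigr => t _; rewrite (bigD1 None) //= addrC natrD mulrDr; congr (_ + _).
  rewrite -sum1dep_card natr_sum mulr_sumr [RHS]big_mkcond /=.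
  rewrite (reindex_omap Some id) /=; last by case.
  apply: eq_big => [v|v _]; first by rewrite eqxx.
  by rewrite /star_cost /= mulr1.
by rewrite /star_cost /=; case: ifP; rewrite ?mul1n ?mul0n ?mulr0.
Qed.

Variables (k : nat) (P : kpart k e) (i : 'I_k).

(** A cheapest cut: in each star it takes the better of isolating the nodes outside [P i] and
    deleting the centre; ties keep the centre. *)
Definition star_cut : {set node} :=
  [set a : node | if a.2 is Some v then (#|~: P i| <= a.1.+1)%N && (v \notin P i)
           else (a.1.+1 < #|~: P i|)%N].

Lemma star_cut_separates : @separates R e star_gadget k star_cut P.
Proof.
apply/forallP => i1; apply/forallP => i2; apply/implyP => ni12.
apply/forall_inP => u ui1; apply/forall_inP => w wi2; apply/negP.
(* Surviving edges preserve the cluster when each private node is put in the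
   cluster of its terminal and each centre in the cluster [i]. *)
pose in_cluster j (x : e + node) := match x with
  | inl v | inr (_, Some v) => v \in P j
  | inr (_, None) => j == i end.
have closed_cluster j :
    closed (@edge_del R e star_gadget star_cut) (in_cluster j).
  move=> x y xy; change (in_cluster j x = in_cluster j y); case/and3P: xy.
  have inrD a : ((inr a : e + node) \in [set inr v | v in star_cut]) =
                (a \in star_cut) by rewrite mem_imset //; exact: inr_inj.
  have eqj v : v \in P i -> (v \in P j) = (j == i).
    move=> vi; apply/idP/eqP => [vj|->//]; exact: kpart_disjoint vj vi.
  case: x y => [v|[s [v|]]] [v'|[t [v'|]]] //=; rewrite ?inrD.
  - by move/eqP->.
  - by move/eqP->.
  (* If the centre survives, all private nodes outside [P i] are deleted, so a surviving neighbour
     of the centre belongs to a terminal of [P i]. *)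
  - move/eqP->; rewrite !inE /= -leqNgt => + le_t; rewrite le_t /= negbK.
    by move/eqj.
  - move/eqP->; rewrite !inE /= -leqNgt => le_t; rewrite le_t /= negbK.
    by move/eqj.
move/(closed_connect (closed_cluster i1)); rewrite unfold_in /= ui1.
by move/esym/kpart_disjoint/(_ wi2)/eqP; rewrite (negPf ni12).
Qed.

Lemma star_cut_cost :
  \sum_(a in star_cut) star_cost a =
  \sum_t c t * (minn #|~: P i| t.+1)%:R.
Proof.
rewrite sum_star_cost; apply: eq_bigr => t _; congr (_ * _%:R).
rewrite inE /=; case: (leqP #|~: P i| t.+1) => le_t /=.
  rewrite mul0n addn0; apply: eq_card => v.
  by rewrite !inE /= le_t.
rewrite mul1n -[RHS]add0n; congr (_ + _)%N; apply/eqP; rewrite cards_eq0.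
by apply/eqP/setP => v; rewrite !inE /= leqNgt le_t.
Qed.

Hypothesis i_largest : largest P i.

Lemma separates_star_cost_ge (D : {set node}) :
  @separates R e star_gadget k D P ->
  \sum_t c t * (minn #|~: P i| t.+1)%:R <= \sum_(a in D) star_cost a.
Proof.
move=> sepD; rewrite sum_star_cost; apply: ler_sum => t _.
apply: ler_wpM2l => //; rewrite ler_nat.
case: (boolP ((t, None) \in D)) => [_|centre].
  by rewrite mul1n geq_min leq_addl orbT.
rewrite mul0n addn0 geq_min; apply/orP; left.
(* [A] collects the terminals whose private node in star [t] is deleted. The others meet at the
   surviving centre, hence share a cluster. *)
set A := [set v | _].
have edgeD (x y : e + node) : star_edge x y ->
    x \notin [set inr v | v in D] -> y \notin [set inr v | v in D] ->
    connect (@edge_del R e star_gadget D) x y.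
  by move=> xy xD yD; apply: connect1; rewrite /edge_del /= xD yD xy.
have inrD a : ((inr a : e + node) \in [set inr v | v in D]) = (a \in D).
  by rewrite mem_imset //; exact: inr_inj.
have inlD u : (inl u : e + node) \notin [set inr v | v in D].
  by apply/imsetP => -[].
have joined u w : u \notin A -> w \notin A ->
    connect (@edge_del R e star_gadget D) (inl u) (inl w).
  rewrite !inE => uA wA.
  apply: (@connect_trans _ _ (inr (t, Some u))).
    by apply: edgeD; rewrite /= ?inrD.
  apply: (@connect_trans _ _ (inr (t, None))).
    by apply: edgeD; rewrite /= ?inrD.
  apply: (@connect_trans _ _ (inr (t, Some w))).
    by apply: edgeD; rewrite /= ?inrD.
  by apply: edgeD; rewrite /= ?inrD.
have [j AP] : exists j, ~: A \subset P j.
  have [A0|[u uA]] := set_0Vmem (~: A); first by exists i; rewrite A0 sub0set.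
  have [j uj] := kpart_clusterP P u; exists j; apply/subsetP => w wA.
  have [l wl] := kpart_clusterP P w.
  have [<-//|njl] := eqVneq l j.
  move/forallP/(_ j)/forallP/(_ l): sepD; rewrite eq_sym njl /=.
  move/forall_inP/(_ u uj)/forall_inP/(_ w wl).
  by rewrite joined // -in_setC.
(* As [P i] is largest, [A] has at least as many nodes as the complement of [P j], hence as that of
   [P i]. *)
have := cardsC A; have := cardsC (P i); have := subset_leq_card AP.
have := i_largest j; lia.
Qed.

Lemma star_gadget_splitting :
  gadget_splitting star_gadget P =
  (\sum_t c t * (minn #|~: P i| t.+1)%:R)%:E.
Proof.
rewrite /gadget_splitting; apply/le_anti/andP; split.
  apply: (le_trans (bigmin_le_cond _ _ star_cut_separates)) => /=.
  by rewrite sumEFin star_cut_cost.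
apply/bigmin_geP; split; first exact: leey.
by move=> D sepD /=; rewrite sumEFin lee_fin separates_star_cost_ge.
Qed.

End StarGadget.

(** Abel summation: weighting truncations by the drops of [d] recovers the partial sums of [d], up
    to a boundary term that vanishes when [d n = 0]. *)
Lemma sum_truncations (R : comPzRingType) (d : nat -> R) (n i : nat) :
  \sum_(t < n) (d t - d t.+1) * (minn i t.+1)%:R =
  \sum_(l < minn i n) d l - (minn i n)%:R * d n.
Proof.
elim: n => [|n IHn]; first by rewrite minn0 !big_ord0; ring.
rewrite big_ord_recr /= IHn; case: (ltnP n i) => ni.
  by rewrite (minn_idPr ni) big_ord_recr /=; ring.
by rewrite (minn_idPl (leqW ni)); ring.
Qed.

(** Apply submodularity to [C :\ x] and [C :\ y], where [C] has [i.+2] elements and [x], [y] are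
    distinct in it. *)
Lemma submodular_card_concave (R : realType) (e : finType) (m : nat -> R) i :
  submodular (fun S : {set e} => m #|S|) -> (i.+2 <= #|e|)%N ->
  m i + m i.+2 <= m i.+1 *+ 2.
Proof.
move=> sub le_ie; have [C Ccard] : exists C : {set e}, #|C| = i.+2.
  exists [set x in take i.+2 (enum e)]; rewrite cardsE.
  by rewrite (card_uniqP (take_uniq _ (enum_uniq _))) size_takel // -cardE.
have [x xC] : exists x, x \in C by apply/card_gt0P; rewrite Ccard.
have := cardsD1 x C; rewrite xC Ccard add1n => -[cx].
have [y yCx] : exists y, y \in C :\ x by apply/card_gt0P; rewrite -cx.
have := cardsD1 y (C :\ x); rewrite yCx -cx add1n => -[cxy].
move: yCx; rewrite !inE => /andP[nyx yC].
have := cardsD1 y C; rewrite yC Ccard add1n => -[cy].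
have := sub (C :\ x) (C :\ y); rewrite -cx -cy.
have -> : (C :\ x) :&: (C :\ y) = (C :\ x) :\ y.
  by apply/setP => v; rewrite !inE; case: (v \in C); rewrite ?andbT ?andbF // andbC.
have -> : (C :\ x) :|: (C :\ y) = C.
  apply/setP => v; rewrite !inE -andb_orl.
  by case: (eqVneq v x) => [->|]; rewrite //= eq_sym nyx.
by rewrite -cxy Ccard mulr2n.
Qed.

Theorem theorem6p10 (R : realType) (k : nat) (hk : (2 <= k)%N)
    (e : finType) (hr : (2 <= #|e|)%N)
    (z : kpart k e -> R) (hz : splitting_function z)
    (m : nat -> R) (hm : move_based z m)
    (hmr : m #|e| = m (#|e| - 2)%N)
    (hsub : submodular (fun S : {set e} => m #|S|)) :
  exists G : nmc_gadget R e, models G z.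
Proof.
have k_gt0 : (0 < k)%N by exact: ltnW.
have m0 : m 0%N = 0.
  case: hz => _ _ z1; pose i0 := Ordinal k_gt0.
  rewrite -(z1 (trivial_kpart e i0)); last first.
    rewrite /nb_clusters -(cards1 i0); apply: eq_card => i.
    rewrite !inE ffunE; case: (i == i0); last by rewrite eqxx.
    by rewrite -card_gt0 cardsT ltnW.
  rewrite (hm _ i0); last first.
    by move=> j; rewrite !ffunE eqxx cardsT max_card.
  by rewrite sum_card_other_clusters /= ffunE eqxx setCT cards0.
(* From here on [#|e|] is [r.+2], and the hypothesis on the extended value reads [m r.+2 = m r]. *)
move: hr hmr; case r_eq: #|e| => [|[|r]] // _; rewrite subSS subSS subn0 => hmr.
have concave i : (i <= r)%N -> m i + m i.+2 <= m i.+1 *+ 2.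
  by move=> ir; apply: submodular_card_concave hsub _; rewrite r_eq.
(* Increments of [m], set to 0 from [r.+1] on so that the boundary term of the Abel summation
   vanishes. *)
pose d t := if (t <= r)%N then m t.+1 - m t else 0.
have d_decr (t : 'I_r.+1) : 0 <= d t - d t.+1.
  have tr : (t <= r)%N by rewrite -ltnS.
  rewrite /d tr; case: ltnP => [_|rt]; have := concave _ tr; first by lra.
  (* The last coefficient is [m r.+1 - m r]; concavity at [r] with [m r.+2 = m r] makes it
     nonnegative. *)
  have -> : t = r :> nat by apply/eqP; rewrite eqn_leq tr.
  by rewrite hmr; lra.
exists (star_gadget e d_decr) => P; have [i i_largest] := exists_largest P k_gt0.
rewrite (star_gadget_splitting d_decr i_largest) sum_truncations.
rewrite (hm P i i_largest) sum_card_other_clusters; congr _%:E.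
(* A largest cluster is nonempty, so the index stays in the range where the truncations reproduce
   [m]. *)
have le_r : (#|~: P i| <= r.+1)%N.
  have [v _] : exists v : e, v \in setT by apply/card_gt0P; rewrite cardsT r_eq.
  have [j vj] := kpart_clusterP P v.
  have : (0 < #|P i|)%N.
    by apply: leq_trans (i_largest j); apply/card_gt0P; exists v.
  by have := cardsC (P i); rewrite r_eq; lia.
rewrite (minn_idPl le_r) {2}/d ltnn mulr0 subr0.
have -> : \sum_(l < #|~: P i|) d l = \sum_(l < #|~: P i|) (m l.+1 - m l).
  by apply: eq_bigr => l _; rewrite /d -ltnS (leq_trans (ltn_ord l)).
by rewrite -(big_mkord xpredT (fun l => m l.+1 - m l)) telescope_sumr // m0 subr0.
Qed.
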